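(* There exist constants $C > 0$ and $d_0$ such that for every integer $d \ge d_0$ there is a function $\varepsilon_d : \mathbb{N} \to \mathbb{R}$ with $\varepsilon_d(n)/n \to 0$ as $n \to \infty$ such that, for all sufficiently large $n$, $$F(n,d) \le 2^{\left(1 + \frac{C}{\sqrt{d}}\right)\frac{n}{d} + \varepsilon_d(n)}.$$ (That is, for fixed $d$ and sufficiently large $n$, $F(n,d) \le 2^{c_d n/d + o(n)}$ with $c_d = 1 + O(1/\sqrt{d})$.)
   Context: For a subset $J \subseteq \mathbb{R}^2$, the stabbing number $\mathrm{stab}(J)$ is the supremum of $|\ell \cap J|$ over all lines $\ell$ for which $\ell \cap J$ is countable. A $d$-curve is a Jordan curve (simple closed plane curve) $J$ with $\mathrm{stab}(J) \le d$. $F(n,d)$ denotes the minimum integer $F$ such that every set of at least $F$ points in the plane in general position (no three collinear) contains a subset of $n$ points lying on some $d$-curve. *)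

(* Defs.v *)
From mathcomp Require Import all_boot all_order all_algebra.
From mathcomp Require Import all_classical all_reals all_analysis.
Set Implicit Arguments.
Unset Strict Implicit.
Unset Printing Implicit Defensive.
Import Order.TTheory GRing.Theory Num.Theory.
Import numFieldNormedType.Exports.
Local Open Scope classical_set_scope.
Local Open Scope ring_scope.

Definition is_line (R : realType) (l : set (R * R)) : Prop :=
  exists a b c : R, (a, b) <> (0, 0) /\
    l = [set p | a * p.1 + b * p.2 = c].

(* [counting A] is the number of points of [A], +oo when [A] is infinite; hence
   a line meeting [J] in a countably infinite set gives [stab J = +oo].
   The supremum is over a nonempty family for every bounded [J]: take a line
   that misses [J]. *)
Definition stab (R : realType) (J : set (R * R)) : \bar R :=
  ereal_sup [set counting (l `&` J) | l in
    [set l : set (R * R) | is_line l /\ countable (l `&` J)]].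

Definition jordan_curve (R : realType) (J : set (R * R)) : Prop :=
  exists g : R -> R * R,
    [/\ {within `[0, 1], continuous g},
        g 0 = g 1,
        set_inj `[0, 1[ g &
        J = g @` `[0, 1]].

Definition d_curve (R : realType) (d : nat) (J : set (R * R)) : Prop :=
  jordan_curve J /\ (stab J <= d%:R%:E)%E.

Definition general_position (R : realType) (P : set (R * R)) : Prop :=
  forall p q r : R * R, P p -> P q -> P r -> p <> q -> q <> r -> p <> r ->
    ~ exists l : set (R * R), [/\ is_line l, l p, l q & l r].

(* [P] ranges over all sets, finite or infinite, with at least [m] points. *)
Definition forces_d_curve (R : realType) (n d m : nat) : Prop :=
  forall P : set (R * R), general_position P -> (`I_m #<= P)%card ->
    exists S J : set (R * R),
      [/\ S `<=` P, (S #= `I_n)%card, d_curve d J & S `<=` J].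

(* [is_F R n d m] means that F(n,d) exists and equals [m]; it does not exist for
   all [n] and [d], so F is given as a relation, not as a total function. *)
Definition is_F (R : realType) (n d m : nat) : Prop :=
  forces_d_curve R n d m /\
  forall m' : nat, forces_d_curve R n d m' -> (m <= m')%N.

(* Main.v *)
(* The exponent n/d leaves so much room that any fixed number of curve points per
   line suffices: for each r there are r clusters, each containing a constant
   fraction (depending on r) of the given points, such that every line meets at
   most two of them; Erdős–Szekeres is then applied in each cluster.

   Clusters (positive fraction Erdős–Szekeres, after Pach and Solymosi).  Sample M
   points at random.  With positive probability no sampled q lies in a region
   spanned by four other sampled points a, b, c, d, namely the region of those q
   between b and c for which a, b, q, c, d is a cap (or a cup), if this region
   contains few of the given points.  A long cap p0 q0 p1 q1 ... of sampled points
   shows that the regions between p_i and p_(i+1) are all rich.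

   Curve.  A rich region contains a cap or cup Q_i of about log_4 of the number of
   points, and the x-monotone path p_1 Q_1 p_2 Q_2 ... p_(r+1) is cut by a line in
   few points: a line that meets three parts of it, u before v before w, would have
   u and w on or below and v on or above a chord of the cap of the p_i.  Two steep
   segments below the path close it up to a Jordan curve.  With r = 2d clusters,
   O(4^(n/2d)) = O(2^(n/d)) points suffice for n points on a 10-curve. *)
Require Import Defs.
From mathcomp Require Import all_boot all_order all_algebra.
From mathcomp Require Import all_classical all_reals all_analysis.
From mathcomp Require Import ring lra zify.
Import Order.TTheory GRing.Theory Num.Theory.
Import numFieldNormedType.Exports.
Local Open Scope classical_set_scope.
Local Open Scope ring_scope.
Set Implicit Arguments.
Unset Strict Implicit.
Unset Printing Implicit Defensive.

(** * Orientation of triples and convex chains *)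

Definition det (R : realType) (a b c : R * R) : R :=
  (b.1 - a.1) * (c.2 - a.2) - (b.2 - a.2) * (c.1 - a.1).

Definition ltx (R : realType) : rel (R * R) := fun a b => a.1 < b.1.

(** Only the sign of [e] matters. For increasing abscissae [turn 1] describes a cup and [turn (-1)]
    a cap, so both are treated at once. *)
Definition turn (R : realType) (e : R) (a b c : R * R) : bool := 0 < e * det a b c.

(** Here [m] counts edges: the vertices are [p 0], ..., [p m]. Only consecutive turns are required;
    [nchain_turn] recovers all triples. *)
Definition nchain (R : realType) (e : R) (m : nat) (p : nat -> R * R) : Prop :=
  (forall i, (i < m)%N -> ltx (p i) (p i.+1)) /\
  (forall i, (i.+1 < m)%N -> turn e (p i) (p i.+1) (p i.+2)).

Ltac nat_lia :=
  repeat match goal with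
  | H : context [Real.sort _] |- _ => clear H
  end; lia.

Section Orientation.
Variable R : realType.
Implicit Types (e : R) (A B D a b c d u v w z : R * R) (p : nat -> R * R).

Lemma ltx_trans : transitive (@ltx R).
Proof. by move=> b a c; rewrite /ltx; apply: lt_trans. Qed.

Lemma ltx_irr : irreflexive (@ltx R).
Proof. by move=> a; rewrite /ltx ltxx. Qed.

(** The map [det A D] is affine. The first two terms interpolate it on the line [a b] at the
    abscissa of [z]; the last one accounts for the vertical offset of [z] from that line. *)
Lemma det_interp A D a b z :
  (b.1 - a.1) * det A D z =
  (b.1 - z.1) * det A D a + (z.1 - a.1) * det A D b
  + (D.1 - A.1) * det a b z.
Proof. rewrite /det; ring. Qed.

Lemma det_rot A D z : det A D z = det z A D.
Proof. rewrite /det; ring. Qed.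

Lemma det_swap A D z : det A D z = - det A z D.
Proof. rewrite /det; ring. Qed.

Lemma det_aab A B : det A A B = 0. Proof. rewrite /det; ring. Qed.
Lemma det_abb A B : det A B B = 0. Proof. rewrite /det; ring. Qed.
Lemma det_aba A B : det A B A = 0. Proof. rewrite /det; ring. Qed.

(** Slopes along a chain are monotone; algebraically, the new turn is a combination of the two given
    ones with positive weights. [turn_transr] is the mirror image. *)
Lemma turn_transl e a b c d : ltx a b -> ltx b c -> ltx c d ->
  turn e a b c -> turn e b c d -> turn e a b d.
Proof.
rewrite /ltx /turn => ab bc cd h1 h2.
have E : (c.1 - b.1) * (e * det a b d) =
   (d.1 - b.1) * (e * det a b c) + (b.1 - a.1) * (e * det b c d).
  by rewrite /det; ring.
have cb : 0 < c.1 - b.1 by lra.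
rewrite -(pmulr_rgt0 _ cb) E; apply: addr_gt0; apply: mulr_gt0 => //; lra.
Qed.

Lemma turn_transr e a b c d : ltx a b -> ltx b c -> ltx c d ->
  turn e a b c -> turn e b c d -> turn e a c d.
Proof.
rewrite /ltx /turn => ab bc cd h1 h2.
have E : (c.1 - b.1) * (e * det a c d) =
   (d.1 - c.1) * (e * det a b c) + (c.1 - a.1) * (e * det b c d).
  by rewrite /det; ring.
have cb : 0 < c.1 - b.1 by lra.
rewrite -(pmulr_rgt0 _ cb) E; apply: addr_gt0; apply: mulr_gt0 => //; lra.
Qed.

Lemma nchain_lt e m p i j : nchain e m p -> (i < j <= m)%N -> ltx (p i) (p j).
Proof.
case=> h _; elim: j => // j IH /andP[]; rewrite ltnS leq_eqVlt => /orP[/eqP->|ij] jm.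
  exact: h.
by apply: ltx_trans (h _ jm); apply: IH; rewrite ij ltnW.
Qed.

Lemma nchain_turnr e m p i k : nchain e m p -> (i.+1 < k <= m)%N ->
  turn e (p i) (p i.+1) (p k).
Proof.
move=> c ik; have lt := nchain_lt c.
have : (i + (k - i.+2).+2 = k)%N by lia.
move: (k - i.+2)%N => g; elim: g i ik => [|g IH] i ik E.
  by rewrite -E addn2; case: c => _; apply; lia.
apply: (@turn_transl e _ _ (p i.+2)); try by apply: lt; lia.
  by case: c => _; apply; lia.
by apply: IH; lia.
Qed.

(** [nchain_turnr] has moved the last index to the right; here the first index is moved to the left,
    by induction on the gap [j - i]. *)
Lemma nchain_turn e m p i j k : nchain e m p -> (i < j < k)%N -> (k <= m)%N ->
  turn e (p i) (p j) (p k).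
Proof.
move=> c ijk km; have lt := nchain_lt c.
have -> : (i = j - (j - i).-1.+1)%N by lia.
have : ((j - i).-1 < j)%N by lia.
elim: (j - i).-1 => [|g IH] gj.
  have {2}-> : j = ((j - 1).+1)%N by lia.
  by apply: nchain_turnr c _; lia.
have E : (j - g.+1 = (j - g.+2).+1)%N by lia.
apply: (@turn_transr e _ (p (j - g.+1)%N)); try by apply: lt; lia.
  have := nchain_turnr c (i := (j - g.+2)%N) (k := j); rewrite -E; apply; lia.
by apply: IH; lia.
Qed.

(** The triangle over an edge of the chain, bounded by that edge and the extensions of its two
    neighbours; the guards cover the first and the last edge. Strictness at the right neighbour
    yields the strict inequality in [no_line_hits_three_blocks]. *)
Definition in_block (e : R) (m : nat) (p : nat -> R * R) (i : nat) (u : R * R) :=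
  [/\ (p i).1 <= u.1 < (p i.+1).1,
      (i.+1 < m)%N -> turn e u (p i.+1) (p i.+2),
      0 <= e * det (p i) u (p i.+1) &
      (0 < i)%N -> 0 <= e * det (p i.-1) (p i) u].

(** The line through [p i.+1] and [p k] decides: [u] is strictly on one side of it, [w] weakly on
    the same side, and [v] weakly on the other. As [v] lies between [u] and [w], the three are not
    collinear. *)
Lemma no_line_hits_three_blocks e m p i j k u v w : nchain e m p ->
  (i < j < k)%N -> (k < m)%N ->
  in_block e m p i u -> in_block e m p j v -> in_block e m p k w ->
  det u v w != 0.
Proof.
move=> c ijk km [/andP[_ u1] uB _ _] [/andP[v0 v1] _ vB _] [/andP[w0 _] _ _ wB].
apply/eqP => uvw.
have lt := nchain_lt c.
have lti i1 i2 : (i1 < i2 <= m)%N -> (p i1).1 < (p i2).1 by apply: lt.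
have lei i1 i2 : (i1 <= i2 <= m)%N -> (p i1).1 <= (p i2).1.
  by case/andP; rewrite leq_eqVlt => /orP[/eqP->//|ab] bm; apply/ltW/lti/andP.
set A := p i.+1; set D := p k.
have AD : A.1 < D.1 by apply: lti; nat_lia.
(* The point [u] prolongs the chain [A], [p i.+2], ..., [D] to the left. *)
have hu : 0 < e * det A D u.
  have uA : turn e u A (p i.+2) by apply: uB; nat_lia.
  rewrite det_rot; have [E|E] : (i.+2 = k \/ i.+2 < k)%N by nat_lia.
    by rewrite /D -E.
  apply: (@turn_transl e _ _ (p i.+2)) => //; try by apply: lt; nat_lia.
  by apply: nchain_turn c _ _; nat_lia.
(* The vertices from [A] to [D] lie on the other side of their chord. *)
have hp l : (i < l <= k)%N -> e * det A D (p l) <= 0.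
  move=> lk.
  have [->|[->|E]] : (l = i.+1 \/ l = k \/ i.+1 < l < k)%N by nat_lia.
  - by rewrite det_aba mulr0.
  - by rewrite det_abb mulr0.
  - rewrite det_swap mulrN oppr_le0; apply: ltW.
    by apply: (nchain_turn c); nat_lia.
(* The edge below or above [v] has both ends on the nonpositive side, and [v] is displaced from it
   further in that direction. *)
have hv : e * det A D v <= 0.
  have pj : 0 < (p j.+1).1 - (p j).1 by rewrite subr_gt0; apply: lti; nat_lia.
  have h1 := hp j ltac:(nat_lia); have h2 := hp j.+1 ltac:(nat_lia).
  rewrite -(pmulr_rle0 _ pj) mulrCA (det_interp A D (p j)) (det_swap (p j)).
  rewrite [X in X <= 0](_ : _ = ((p j.+1).1 - v.1) * (e * det A D (p j)) +
     (v.1 - (p j).1) * (e * det A D (p j.+1)) -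
     (D.1 - A.1) * (e * det (p j) v (p j.+1))); last by ring.
  have := mulr_ge0_le0 (ltW (_ : 0 < (p j.+1).1 - v.1)) h1.
  have := @mulr_ge0_le0 _ (v.1 - (p j).1) _ _ h2.
  have := @mulr_ge0 _ (D.1 - A.1) _ _ vB.
  lra.
(* Extrapolation beyond [D] along the edge that ends at [D]. *)
have hw : 0 <= e * det A D w.
  have pj : 0 < D.1 - (p k.-1).1 by rewrite subr_gt0; apply: lti; nat_lia.
  have h1 := hp k.-1 ltac:(nat_lia).
  have h3 := wB ltac:(nat_lia).
  rewrite -(pmulr_rge0 _ pj) mulrCA (det_interp A D (p k.-1) D).
  rewrite [X in 0 <= X](_ : _ = - ((w.1 - D.1) * (e * det A D (p k.-1))) +
     (D.1 - A.1) * (e * det (p k.-1) D w)); last by rewrite det_abb; ring.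
  have := @mulr_ge0_le0 _ (w.1 - D.1) _ _ h1.
  have := @mulr_ge0 _ (D.1 - A.1) _ _ h3.
  have : (p k).1 <= w.1 by [].
  rewrite -/D; lra.
have Av : A.1 <= v.1 by apply: le_trans v0; apply: lei; nat_lia.
have vD : v.1 < D.1 by apply: lt_le_trans v1 _; apply: lei; nat_lia.
have E := det_interp A D u w v.
have : (w.1 - u.1) * (e * det A D v) =
   (w.1 - v.1) * (e * det A D u) + (v.1 - u.1) * (e * det A D w).
  by rewrite mulrCA E (_ : det u w v = 0) ?(det_swap u w) ?uvw ?oppr0 //; ring.
have uv : u.1 < v.1 by apply: lt_le_trans u1 Av.
have vw : v.1 < w.1 by apply: lt_le_trans vD w0.
have := @mulr_gt0 _ (w.1 - v.1) _ _ hu.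
have := @mulr_ge0 _ (v.1 - u.1) _ _ hw.
have := @mulr_ge0_le0 _ (w.1 - u.1) _ _ hv.
lra.
Qed.

End Orientation.

(** * Clusters of positive density *)

Section Resampling.
Variables (I T : finType).
Implicit Types (f : {ffun I -> T}) (m : I).

Definition update f m (y : T) : {ffun I -> T} :=
  [ffun i => if i == m then y else f i].

(* [(f, y) |-> (update f m y, f m)] is an involution. *)
Lemma card_resample (P : pred {ffun I -> T}) m :
  (#|T| * #|[pred f | P f]| = \sum_f #|[pred y | P (update f m y)]|)%N.
Proof.
under eq_bigr do rewrite -sum1_card.
rewrite (exchange_big_dep xpredT) //=.
pose h (x : T * {ffun I -> T}) := (x.2 m, update x.2 m x.1).
have hK : involutive h.
  case=> y f; rewrite /h /= ffunE eqxx; congr pair.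
  by apply/ffunP => i; rewrite !ffunE; case: eqP => [->|].
rewrite pair_big_dep /= (reindex_inj (inv_inj hK)) /=.
rewrite (eq_bigl (fun x : T * {ffun I -> T} => P x.2)); last first.
  move=> [y f]; rewrite /= inE /=; congr P.
  by have := hK (y, f); rewrite /h /= => -[].
rewrite -(pair_big_dep xpredT (fun _ f => P f) (fun _ _ => 1%N)) /=.
by rewrite sum_nat_const sum1_card.
Qed.

End Resampling.

(** A union bound over the [M ^ 5] index tuples: resampling the coordinate [m] alone leaves
    [B (f i) (f j) (f k) (f l)] fixed, so each bad event has probability at most [t / #|T|]. *)
Lemma avoid_small_sets (T : finType) (M t : nat) (B : T -> T -> T -> T -> {set T}) :
  (forall a b c d, #|B a b c d| <= t)%N -> (M ^ 5 * t < #|T|)%N ->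
  exists f : {ffun 'I_M -> T}, forall i j k l m : 'I_M,
    m != i -> m != j -> m != k -> m != l -> f m \notin B (f i) (f j) (f k) (f l).
Proof.
move=> Bt MT; apply: contrapT => /forallNP nf.
pose I5 : finType := ('I_M * 'I_M * 'I_M * 'I_M * 'I_M)%type.
pose bad (x : I5) (f : {ffun 'I_M -> T}) :=
  let: (i, j, k, l, m) := x in
  [&& m != i, m != j, m != k, m != l & f m \in B (f i) (f j) (f k) (f l)].
have cover f : exists x, bad x f.
  apply: contrapT => /forallNP nb; apply: (nf f) => i j k l m mi mj mk ml.
  by apply/negP => Bf; apply: (nb (i, j, k, l, m)); rewrite /bad mi mj mk ml.
have badt x : (#|T| * #|[pred f | bad x f]| <= #|{ffun 'I_M -> T}| * t)%N.
  case: x => -[[[i j] k] l] m.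
  rewrite (card_resample _ m) -sum_nat_const; apply: leq_sum => f _.
  have [/and4P[mi mj mk ml]|] := boolP [&& m != i, m != j, m != k & m != l].
    apply: leq_trans (Bt (f i) (f j) (f k) (f l)).
    apply: subset_leq_card; apply/fintype.subsetP => y.
    rewrite inE /= => /and5P[_ _ _ _].
    by rewrite !ffunE eqxx ![i == _]eq_sym ![j == _]eq_sym ![k == _]eq_sym
      ![l == _]eq_sym (negbTE mi) (negbTE mj) (negbTE mk) (negbTE ml).
  move=> nm; rewrite eq_card0 // => y; rewrite inE /=.
  by apply/negP => /and5P[a b c d _]; rewrite a b c d in nm.
have T0 : (0 < #|T|)%N by apply: leq_trans MT.
have F0 : (0 < #|{ffun 'I_M -> T}|)%N.
  by case/card_gt0P: T0 => x _; apply/card_gt0P; exists [ffun=> x].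
(* If no [f] were good, the bad events would cover all samples. *)
have : (#|{ffun 'I_M -> T}| <= \sum_x #|[pred f | bad x f]|)%N.
  rewrite -sum1_card.
  under [leqRHS]eq_bigr do rewrite -sum1_card.
  rewrite (exchange_big_dep xpredT) //=; apply: leq_sum => f _.
  by have [x bx] := cover f; rewrite (bigD1 x) ?inE //= leq_addr.
rewrite leqNgt => /negP; apply.
rewrite -(ltn_pmul2l T0) big_distrr /=.
apply: (@leq_ltn_trans (\sum_(x : I5) #|{ffun 'I_M -> T}| * t)%N).
  by apply: leq_sum => x _; apply: badt.
have cI : (M ^ 5 = #|{: I5}|)%N.
  by rewrite !card_prod !card_ord !expnS expn0 muln1 !mulnA.
by rewrite sum_nat_const -cI mulnCA (mulnC #|T|) ltn_pmul2l.
Qed.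

(** * Caps and cups: the Erdős-Szekeres theorem *)

Section ErdosSzekeres.
Variable R : realType.
Implicit Types (a b c d p q : R * R) (s t u : seq (R * R)).

Definition generic s : Prop :=
  forall a b c, a \in s -> b \in s -> c \in s -> ltx a b -> ltx b c ->
  det a b c != 0.

Fixpoint turning (e : R) s : bool :=
  match s with
  | a :: ((b :: c :: _) as s') => turn e a b c && turning e s'
  | _ => true
  end.

Lemma turning_rcons e u a b c : turning e (rcons (rcons u a) b) ->
  turn e a b c -> turning e (rcons (rcons (rcons u a) b) c).
Proof.
elim: u => [|x u IH] /=; first by move=> _ ->.
by case: u IH => [|y [|z u]] IH /= /andP[-> h] abc; exact: IH.
Qed.

Lemma turn_total a b c : det a b c != 0 -> turn 1 a b c \/ turn (-1) a b c.
Proof.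
by rewrite /turn mul1r mulN1r oppr_gt0 neq_lt => /orP[]; [right|left].
Qed.

Lemma sorted_ltx_uniq s : sorted (@ltx R) s -> uniq s.
Proof. exact: (sorted_uniq (@ltx_trans R) (@ltx_irr R)). Qed.

Lemma sorted_ltx_rcons s b c : sorted (@ltx R) (rcons s b) -> ltx b c ->
  sorted (@ltx R) (rcons (rcons s b) c).
Proof.
case: s => [|x s] /=; first by move=> _ ->.
by rewrite !rcons_path !last_rcons => -> ->.
Qed.

Lemma generic_sub s t : generic s -> {subset t <= s} -> generic t.
Proof. by move=> g st a b c /st + /st + /st; apply: g. Qed.

(** The classical induction, with the recurrence of the binomial coefficients replaced by doubling.
    The indices [k] and [l] count edges, hence the sizes [k.+1] and [l.+1]. *)
Lemma erdos_szekeres k l s : sorted (@ltx R) s -> generic s ->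
  (2 ^ (k + l) <= size s)%N ->
  (exists t, [/\ sorted (@ltx R) t, {subset t <= s}, turning 1 t & size t = k.+1]) \/
  (exists t, [/\ sorted (@ltx R) t, {subset t <= s}, turning (-1) t & size t = l.+1]).
Proof.
have one s' : (0 < size s')%N -> exists2 x, x \in s' & True.
  by case: s' => // x s' _; exists x; rewrite ?mem_head.
elim: k l s => [|k IHk] l s ss gs; first case/(leq_trans _)/one => [|x xs _].
- by rewrite expn_gt0.
- by left; exists [:: x]; split => // y; rewrite inE => /eqP->.
elim: l s ss gs => [|l IHl] s ss gs sz.
  case/(leq_trans _)/one: sz => [|x xs _]; first by rewrite expn_gt0.
  by right; exists [:: x]; split => // y; rewrite inE => /eqP->.
(* Left ends of [1]-turning chains with [k.+1] points. One of the two halves [E] and [E'] is large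
   enough for an induction hypothesis. *)
pose capleft p := `[< exists t, [/\ sorted (@ltx R) (p :: t),
  {subset p :: t <= s}, turning 1 (p :: t) & size t = k] >].
pose E := seq.filter capleft s; pose E' := seq.filter (predC capleft) s.
have sub (P : pred (R * R)) : {subset seq.filter P s <= s}.
  by move=> x; rewrite mem_filter => /andP[].
have sor (P : pred (R * R)) : sorted (@ltx R) (seq.filter P s).
  by apply: sorted_filter ss; apply: ltx_trans.
have szE : (size E + size E' = size s)%N by rewrite !size_filter count_predC.
(* Two points form a chain of either sign; they serve when one of the chains to be joined is a
   single point. *)
have two : exists a b, [/\ a \in s, b \in s & ltx a b].
  have : (1 < size s)%N.
    apply: leq_trans sz; rewrite addSn expnS mul2n -addnn.
    by rewrite -[2%N]/(1 + 1)%N leq_add ?expn_gt0.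
  case: s ss {sz gs capleft E E' sub sor szE} => [|a [|b s]] //=.
  by case/andP=> ab _ _; exists a, b; rewrite !inE !eqxx ?orbT.
have [E2|E2] := leqP (2 ^ (k + l.+1)) (size E').
  have [[t [ts tE tt tk]]|[t [ts tE tt tk]]] := IHk _ _ (sor _) (generic_sub gs (@sub _)) E2.
    (* A [1]-turning chain inside [E'] would have its left end in [E]. *)
    case: t ts tE tt tk => // p t ts tE tt [tk].
    have := tE p (mem_head _ _); rewrite mem_filter /= => /andP[/asboolP[]].
    by exists t; split => // x /tE/sub.
  by right; exists t; split => // x /tE/sub.
have {}E2 : (2 ^ (k.+1 + l) <= size E)%N.
  move: sz E2; rewrite -szE !addSn !addnS !expnS; lia.
have [[t [ts tE tt tk]]|[u [us uE uu uk]]] := IHl _ (sor _) (generic_sub gs (@sub _)) E2.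
  by left; exists t; split => // x /tE/sub.
case/lastP: u us uE uu uk => // u b us uE uu; rewrite size_rcons => -[ul].
have := uE b; rewrite mem_rcons mem_head mem_filter => /(_ isT)/andP[/asboolP].
move=> [t [ts tE tt tk]] bs.
have [a0 [b0 [a0s b0s ab0]]] := two.
have sub2 : {subset [:: a0; b0] <= s}.
  by move=> x; rewrite !inE => /orP[/eqP->|/eqP->].
case/lastP: u us uE uu ul => [|u a] us uE uu ul.
  by right; exists [:: a0; b0]; split; rewrite //= ?ab0 // -ul.
case: t ts tE tt tk => [|c t] ts tE tt tk.
  by left; exists [:: a0; b0]; split; rewrite //= ?ab0 // -tk.
(* A [-1]-turning chain ending in [a], [b] meets a [1]-turning chain starting with [b], [c]; the
   turn at [b] decides which of them grows by one point. *)
have ab : ltx a b.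
  move: us; case: u {uE uu ul} => [|x u] /=; first by case/andP.
  by rewrite !rcons_path last_rcons => /andP[].
have bc : ltx b c by move: ts => /= /andP[].
have as_ : a \in s by apply/sub/uE; rewrite mem_rcons inE mem_rcons inE eqxx orbT.
have cs : c \in s by apply: tE; rewrite !inE eqxx orbT.
have [h|h] := turn_total (gs _ _ _ as_ bs cs ab bc).
  left; exists (a :: b :: c :: t); split.
  - by move: ts => /= ->; rewrite ab.
  - by move=> x; rewrite inE => /orP[/eqP->//|]; apply: tE.
  - by move: tt => /= ->; rewrite h.
  - by rewrite /= -tk.
right; exists (rcons (rcons (rcons u a) b) c); split.
- exact: sorted_ltx_rcons.
- move=> x; rewrite mem_rcons inE => /orP[/eqP->//|/uE/sub //].
- exact: turning_rcons.
- by rewrite size_rcons -ul !size_rcons.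
Qed.

(** A Boolean sign leaves just two families of regions to be avoided in [rich_regions]. *)
Definition sgn (b : bool) : R := if b then -1 else 1.

Lemma erdos_szekeres_diag k s : sorted (@ltx R) s -> generic s ->
  (4 ^ k <= size s)%N -> exists (sb : bool) t, [/\ sorted (@ltx R) t, {subset t <= s},
    turning (sgn sb) t & size t = k.+1].
Proof.
move=> ss gs; rewrite -[4%N]/(2 ^ 2)%N -expnM mul2n -addnn => sz.
by have [[t ?]|[t ?]] := erdos_szekeres ss gs sz; [exists false|exists true]; exists t.
Qed.

Lemma nchain_nth e d t : sorted (@ltx R) t -> turning e t ->
  nchain e (size t).-1 (nth d t).
Proof.
move=> ts tt; split => [i it|i].
  by apply: (sortedP d ts); lia.
elim: t i ts tt => [|a t IH] i //.
case: t IH => [|b [|c t]] IH //= /andP[ab ts] /andP[abc tt].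
by case: i => [|i] // h; apply: IH.
Qed.

(** When [a], [b], [c], [d] is a chain, this is the open triangle bounded by the chord [b c] and the
    extensions of [a b] and [c d]. *)
Definition region e a b c d q : bool :=
  [&& ltx b q, ltx q c, turn e a b q, turn e b q c & turn e q c d].

End ErdosSzekeres.

(** * The positive fraction Erdős-Szekeres theorem *)

Section PositiveFraction.
Variable R : realType.
Implicit Types (a b c d p q : R * R) (s t u : seq (R * R)).

Lemma nchain_double e m (p : nat -> R * R) : nchain e m.*2 p ->
  nchain e m (fun i => p i.*2).
Proof.
move=> c; split=> i im; first by apply: (nchain_lt c); lia.
by apply: (nchain_turn c); lia.
Qed.

(** For even [i], a vertex of odd index lies in the region spanned by the two vertices of even index
    on either side of it. *)
Lemma nchain_region e m (p : nat -> R * R) i : nchain e m p -> (i.+4.+2 <= m)%N ->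
  region e (p i) (p i.+2) (p i.+4) (p i.+4.+2) (p i.+3).
Proof.
move=> c im; rewrite /region.
by rewrite !(nchain_lt c) ?(nchain_turn c) //; lia.
Qed.

Lemma card_count (x0 : R * R) s (P : pred (R * R)) :
  #|[set i : 'I_(size s) | P (nth x0 s i)]%SET| = count P s.
Proof.
have E : s = [seq nth x0 s (val i) | i : 'I_(size s)].
  by rewrite -[LHS](mkseq_nth x0 s) /mkseq -val_enum_ord -map_comp.
rewrite [in RHS]E count_map cardsE cardE /enum_mem size_filter.
by rewrite (eq_filter (a2 := predT)) ?filter_predT //; apply: eq_count.
Qed.

(* Pach and Solymosi: among the many caps and cups, one can fix the points of
   even index so that those of odd index vary in large regions. *)
Lemma rich_regions (r : nat) : exists2 D : nat, (0 < D)%N &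
  forall s, sorted (@ltx R) s -> generic s -> (D <= size s)%N ->
  exists e (p : nat -> R * R), [/\ nchain e r.+2 p,
    forall i, (i <= r.+2)%N -> p i \in s &
    forall i, (i < r)%N ->
      (size s < D * count (region e (p i) (p i.+1) (p i.+2) (p i.+3)) s)%N].
Proof.
(* A sample of [M] points contains a chain with [m.*2] edges. The factor 4 in [D] splits the union
   bound: the poor regions cost at most half of [size s], the singletons at most a quarter. *)
set m := r.+2; pose M := (4 ^ m.*2)%N; pose D := (4 * M ^ 5)%N.
have M0 : (0 < M ^ 5)%N by rewrite !expn_gt0.
exists D => [|s ss gs Ds]; first by rewrite muln_gt0.
pose x0 : R * R := (0, 0); pose pt (i : 'I_(size s)) := nth x0 s i.
pose reg e (a b c d : 'I_(size s)) := region e (pt a) (pt b) (pt c) (pt d).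
pose poor e i j k l := (D * count (reg e i j k l) s <= size s)%N.
pose poorset e i j k l := if poor e i j k l then
  [set q : 'I_(size s) | reg e i j k l (pt q)]%SET else finset.set0.
(* The singleton of [i] makes the sample injective; the poor sets are taken for both signs, as the
   sign of the chain is not known beforehand. *)
pose B i j k l : {set 'I_(size s)} :=
  (i |: (poorset 1%R i j k l :|: poorset (-1)%R i j k l))%SET.
have pc e i j k l : (#|poorset e i j k l| <= size s %/ D)%N.
  rewrite /poorset; case: ifP => [|_]; last by rewrite cards0.
  by rewrite /poor mulnC card_count leq_divRL // muln_gt0.
have Bt i j k l : (#|B i j k l| <= (size s %/ D).*2.+1)%N.
  rewrite /B (leq_trans (leq_card_setU _ _)) // cards1 add1n ltnS.
  by rewrite (leq_trans (leq_card_setU _ _)) // -addnn leq_add.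
have [|f Hf] := avoid_small_sets (M := M) Bt.
  rewrite card_ord; have := leq_trunc_div (size s) D; move: M0 Ds.
  rewrite /D; move: (M ^ 5)%N (size s %/ _)%N => X Y; nia.
have finj : injective f.
  move=> i j E; apply/eqP; apply: contraT => ij.
  by have := Hf j j j j i ij ij ij ij; rewrite /B E !inE eqxx.
have su := sorted_ltx_uniq ss.
have ptinj : injective pt.
  by move=> i j /eqP; rewrite nth_uniq // => /eqP/val_inj.
pose s' := [seq x <- s | x \in codom (pt \o f)].
have ss' : sorted (@ltx R) s' by apply: sorted_filter ss; apply: ltx_trans.
have s's : {subset s' <= s} by move=> x; rewrite mem_filter => /andP[].
have sz' : (4 ^ m.*2 <= size s')%N.
  rewrite -/M -[M]card_ord -(size_codom (pt \o f)).
  apply: uniq_leq_size.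
    by rewrite /codom /image_mem map_inj_uniq ?enum_uniq // => i j /ptinj/finj.
  move=> x xf; rewrite mem_filter xf /=.
  by case/codomP: xf => i ->; apply: mem_nth.
have [sb [t [ts tsub tt tk]]] := erdos_szekeres_diag ss' (generic_sub gs s's) sz'.
have c := nchain_nth x0 ts tt; rewrite tk /= in c.
(* Every other vertex is kept. If a region of kept vertices were poor, the skipped vertex [i.*2.+3]
   would be a sampled point inside it. *)
exists (sgn R sb), (fun i => nth x0 t i.*2); split; first exact: nchain_double.
  by move=> i im; apply/s's/tsub; rewrite mem_nth // tk ltnS leq_double.
move=> i ir; rewrite ltnNge; apply/negP => le.
have ix j : (j <= m.*2)%N -> exists x : 'I_M, nth x0 t j = pt (f x).
  move=> jm; have /tsub : nth x0 t j \in t by rewrite mem_nth // tk.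
  by rewrite mem_filter => /andP[/codomP[x ->] _]; exists x.
have i2 : (i.*2.+4.+2 <= m.*2)%N by rewrite /m; lia.
have [ja Ea] := ix i.*2 ltac:(nat_lia); have [jb Eb] := ix i.*2.+2 ltac:(nat_lia).
have [jc Ec] := ix i.*2.+4 ltac:(nat_lia); have [jd Ed] := ix i.*2.+4.+2 ltac:(nat_lia).
have [jq Eq] := ix i.*2.+3 ltac:(nat_lia).
have dif j k x y : nth x0 t j = pt (f x) -> nth x0 t k = pt (f y) ->
    (j <= m.*2)%N -> (k <= m.*2)%N -> j != k -> x != y.
  move=> Ex Ey jm km; apply: contraNneq => xy.
  by rewrite -(nth_uniq x0 _ _ (sorted_ltx_uniq ts)) ?tk // Ex Ey xy.
have := Hf ja jb jc jd jq (dif _ _ _ _ Eq Ea _ _ _) (dif _ _ _ _ Eq Eb _ _ _)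
  (dif _ _ _ _ Eq Ec _ _ _) (dif _ _ _ _ Eq Ed _ _ _).
rewrite /B !inE negb_or => H.
have /andP[_] : (f jq != f ja) && ~~ ((f jq \in poorset 1 (f ja) (f jb) (f jc) (f jd))
  || (f jq \in poorset (-1) (f ja) (f jb) (f jc) (f jd))) by apply: H; nat_lia.
apply/negP/negPn.
suff : f jq \in poorset (sgn R sb) (f ja) (f jb) (f jc) (f jd).
  by rewrite /sgn; case: (sb) => ->; rewrite ?orbT.
rewrite /poorset; case: ifP => [_|/negbT/negP[]].
  by rewrite inE /reg -Ea -Eb -Ec -Ed -Eq; apply: (nchain_region c).
by move: le; rewrite /poor /reg -Ea -Eb -Ec -Ed !doubleS.
Qed.

(** A rich region holds more than [size s / D], hence at least [4 ^ k], of the points. The sign of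
    the chain [Q i] may differ from [e] and vary with [i]. *)
Lemma rich_clusters (r : nat) : exists2 D : nat, (0 < D)%N &
  forall k s, sorted (@ltx R) s -> generic s -> (D * 4 ^ k <= size s)%N ->
  exists e (p : nat -> R * R) (Q : nat -> seq (R * R)), [/\ nchain e r.+2 p,
    forall i, (i <= r.+2)%N -> p i \in s &
    forall i, (i < r)%N ->
      [/\ sorted (@ltx R) (Q i), {subset Q i <= s}, size (Q i) = k.+1,
          all (region e (p i) (p i.+1) (p i.+2) (p i.+3)) (Q i) &
          exists e', turning e' (Q i)]].
Proof.
have [D D0 HD] := rich_regions r; exists D => // k s ss gs sz.
have [|e [p [c ps H]]] := HD s ss gs.
  by apply: leq_trans sz; rewrite -[X in (X <= _)%N]muln1 leq_mul2l expn_gt0 orbT.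
have /choice[Q HQ] : forall i, exists q : seq (R * R), (i < r)%N ->
   [/\ sorted (@ltx R) q, {subset q <= s}, size q = k.+1,
          all (region e (p i) (p i.+1) (p i.+2) (p i.+3)) q &
          exists e', turning e' q].
  move=> i; have [ir|ir] := ltnP i r; last by exists [::].
  set P := region e (p i) (p i.+1) (p i.+2) (p i.+3).
  have sub : {subset seq.filter P s <= s} by move=> x; rewrite mem_filter => /andP[].
  have [|b [t [ts tsub tt tk]]] := @erdos_szekeres_diag R k (seq.filter P s)
    (sorted_filter (@ltx_trans R) P ss) (generic_sub gs sub).
    rewrite size_filter -(leq_pmul2l D0); apply: leq_trans sz _.
    exact/ltnW/H.
  exists t => _; split => //; first by move=> x /tsub/sub.
  - by apply/allP => x /tsub; rewrite mem_filter => /andP[].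
  - by exists (sgn R b).
by exists e, p, Q.
Qed.

End PositiveFraction.

(** * Lines meeting a path of clusters *)

Section Hits.
Variable R : realType.
Implicit Types (a b c d p q u v w x : R * R) (s t : seq (R * R)).

Fixpoint edges s : seq ((R * R) * (R * R)) :=
  match s with
  | a :: ((b :: _) as s') => (a, b) :: edges s'
  | _ => [::]
  end.

Lemma edges_cons2 a b s : edges (a :: b :: s) = (a, b) :: edges (b :: s).
Proof. by []. Qed.

Lemma edges_cat s x t : edges (s ++ x :: t) = edges (rcons s x) ++ edges (x :: t).
Proof. by elim: s => [|a [|b s] IH] //=; rewrite -IH. Qed.

Lemma edges_nth x0 s :
  edges s = [seq (nth x0 s i, nth x0 s i.+1) | i <- iota 0 (size s).-1].
Proof.
elim: s => [|a [|b s] IH] //; rewrite edges_cons2 IH /=; congr cons.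
by rewrite -[1%N]/(1 + 0)%N iotaDl -map_comp.
Qed.

Lemma edgesP (e : (R * R) * (R * R)) x s : sorted (@ltx R) (x :: s) ->
  e \in edges (x :: s) -> [/\ e.1 \in belast x s, e.2 \in s & ltx e.1 e.2].
Proof.
elim: s x => [|y s IH] x //= /andP[xy sy].
rewrite inE => /orP[/eqP->|]; first by rewrite /= !mem_head.
by move=> /(IH _ sy)[h1 h2 h3]; split; rewrite // inE ?h1 ?h2 orbT.
Qed.

(** Half-open, so that consecutive edges of a sorted path are disjoint; the last point of a path
    lies on none of its segments. *)
Definition segment (e : (R * R) * (R * R)) : set (R * R) :=
  [set u | e.1.1 <= u.1 < e.2.1 /\ det e.1 e.2 u = 0].

Lemma segment_interp A D e u : segment e u ->
  (e.2.1 - e.1.1) * det A D u =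
  (e.2.1 - u.1) * det A D e.1 + (u.1 - e.1.1) * det A D e.2.
Proof. by case=> _ h; rewrite (det_interp A D e.1 e.2) h mulr0 addr0. Qed.

Lemma segment_ge0 (r : R) A D e u : segment e u ->
  0 <= r * det A D e.1 -> 0 <= r * det A D e.2 -> 0 <= r * det A D u.
Proof.
move=> eu h1 h2; have E := segment_interp A D eu.
case: eu => /andP[u1 u2] _.
have l : 0 < e.2.1 - e.1.1 by rewrite subr_gt0; apply: le_lt_trans u2.
rewrite -(pmulr_rge0 _ l) mulrCA E mulrDr !(mulrCA r).
by apply: addr_ge0; apply: mulr_ge0 => //; rewrite subr_ge0 // ltW.
Qed.

(** Strictness at the left end suffices, because the segment omits its right end. *)
Lemma segment_gt0 (r : R) A D e u : segment e u ->
  0 < r * det A D e.1 -> 0 <= r * det A D e.2 -> 0 < r * det A D u.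
Proof.
move=> eu h1 h2; have E := segment_interp A D eu.
case: eu => /andP[u1 u2] _.
have l : 0 < e.2.1 - e.1.1 by rewrite subr_gt0; apply: le_lt_trans u2.
rewrite -(pmulr_rgt0 _ l) mulrCA E mulrDr !(mulrCA r).
apply: ltr_wpDr; first by apply: mulr_ge0 => //; rewrite subr_ge0.
by apply: mulr_gt0 => //; rewrite subr_gt0.
Qed.

Variable l : set (R * R).
Hypothesis lP : forall u v w, l u -> l v -> l w -> det u v w = 0.

Definition hit (e : (R * R) * (R * R)) : bool :=
  `[< exists u, segment e u /\ l u >].

Lemma count_le2 (P : pred nat) n :
  (forall i j k, (i < j < k)%N -> (k < n)%N -> P i -> P j -> P k -> False) ->
  (count P (iota 0 n) <= 2)%N.
Proof.
move=> h; rewrite -size_filter.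
have : sorted ltn [seq x <- iota 0 n | P x].
  by apply: sorted_filter; [apply: ltn_trans | apply: iota_ltn_sorted].
have : all (fun i => P i && (i < n)%N) [seq x <- iota 0 n | P x].
  by apply/allP => i; rewrite mem_filter mem_iota.
case: [seq x <- iota 0 n | P x] => [|i [|j [|k s]]] //=.
case/and4P => /andP[Pi _] /andP[Pj _] /andP[Pk kn] _ /and3P[ij jk _].
by case: (@h i j k) => //; rewrite ij.
Qed.

(** Each edge lies in its own block of the chain, so three hit edges would contradict
    [no_line_hits_three_blocks]. *)
Lemma chain_hits e t : sorted (@ltx R) t -> turning e t ->
  (count hit (edges t) <= 2)%N.
Proof.
move=> ts tt; pose x0 : R * R := 0; rewrite (edges_nth x0) count_map.
have c := nchain_nth x0 ts tt; set m := (size t).-1 in c *.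
have blk i u : (i < m)%N -> segment (nth x0 t i, nth x0 t i.+1) u ->
    in_block e m (nth x0 t) i u.
  move=> im hu; case: (hu) => /= iu du.
  case: c => _ c; split => //.
  - move=> h; rewrite /turn -det_rot; apply: (segment_gt0 hu) => /=.
      by rewrite det_rot; apply: c.
    by rewrite det_rot det_aab mulr0.
  - by rewrite det_swap du oppr0 mulr0.
  - move=> i0; apply: (segment_ge0 hu) => /=; first by rewrite det_abb mulr0.
    by have := c i.-1; rewrite prednK // => /(_ im)/ltW.
apply: count_le2 => i j k ijk km /asboolP[u [su lu]] /asboolP[v [sv lv]]
  /asboolP[w [sw lw]].
have := no_line_hits_three_blocks c ijk km (blk _ _ _ su) (blk _ _ _ sv) (blk _ _ _ sw).
by rewrite (lP lu lv lw) eqxx => H; suff: false by []; apply: H; nat_lia.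
Qed.

Lemma count_edges_cons x s : (count hit (edges (x :: s)) <= (count hit (edges s)).+1)%N.
Proof. by case: s => //= y s; case: (hit _). Qed.

Lemma count_edges_rcons s x :
  (count hit (edges (rcons s x)) <= (count hit (edges s)).+1)%N.
Proof.
elim: s => [|a [|b s] IH] //=; first by case: (hit _).
by rewrite -addnS leq_add2l.
Qed.

End Hits.

Section Path.
Variable R : realType.
Variables (e : R) (p : nat -> R * R) (Q : nat -> seq (R * R)) (r : nat).
Hypothesis c : nchain e r.+2 p.
Hypothesis Qs : forall i, (i < r)%N -> sorted (@ltx R) (Q i).
Hypothesis Qr : forall i, (i < r)%N ->
  all (region e (p i) (p i.+1) (p i.+2) (p i.+3)) (Q i).
Hypothesis Qt : forall i, (i < r)%N -> exists e', turning e' (Q i).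

(* [Q i] lies between [p i.+1] and [p i.+2]; the end points [p 0] and [p r.+2] only
   serve to delimit the first and the last region. *)
Fixpoint path_from i n : seq (R * R) :=
  if n is n'.+1 then p i.+1 :: Q i ++ path_from i.+1 n' else [:: p i.+1].

Definition block i := p i.+1 :: rcons (Q i) (p i.+2).

Lemma path_fromE i n : path_from i n = p i.+1 :: behead (path_from i n).
Proof. by case: n. Qed.

Lemma block_sorted i : (i < r)%N -> sorted (@ltx R) (block i).
Proof.
move=> ir; have := Qs ir; have /allP := Qr ir; rewrite /block /=.
have lt : ltx (p i.+1) (p i.+2) by case: c => h _; apply: h; nat_lia.
case: (Q i) => [|q s] H /=; first by rewrite lt.
rewrite rcons_path => ->.
have /and5P[-> _ _ _ _] := H q (mem_head _ _).
by have /and5P[_ -> _ _ _] := H (last q s) (mem_last _ _).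
Qed.

Lemma path_from_sorted i n : (i + n <= r)%N -> sorted (@ltx R) (path_from i n).
Proof.
elim: n i => //= n IH i inr.
have := IH i.+1; rewrite (path_fromE i.+1) => H.
have := @block_sorted i; rewrite /block /= -cats1 !cat_path /=.
have -> : (i < r)%N by nat_lia.
case/(_ isT)/and3P => -> -> _ /=.
by apply: H; nat_lia.
Qed.

Lemma edges_path_from i n :
  edges (path_from i n.+1) = edges (block i) ++ edges (path_from i.+1 n).
Proof. by rewrite [path_from i n.+1]/= (path_fromE i.+1) -cat_cons edges_cat. Qed.

Lemma size_path_from k i n : (i + n <= r)%N ->
  (forall j, (j < r)%N -> size (Q j) = k) -> (k * n <= size (path_from i n))%N.
Proof.
move=> inr sz; elim: n i inr => [|n IH] i inr; first by rewrite muln0.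
rewrite /= size_cat mulnS sz; last by nat_lia.
by apply/leqW; rewrite leq_add2l IH //; nat_lia.
Qed.

(** All vertices of [block i] satisfy the inequalities weakly, and these are affine along each edge.
    The strict one fails only at [p i.+2], which is never a left end. The index is [i.+1] because
    the block starts at [p i.+1]. *)
Lemma block_in_block i ab u : (i < r)%N -> ab \in edges (block i) ->
  segment ab u -> in_block e r.+2 p i.+1 u.
Proof.
move=> ir iab su; have lt := nchain_lt c.
have [] := edgesP (block_sorted ir) iab; rewrite belast_rcons => a1 b1 ltab.
have tp j : (j < r)%N -> turn e (p j) (p j.+1) (p j.+2).
  by move=> jr; case: c => _; apply; nat_lia.
have t0 : turn e (p i) (p i.+1) (p i.+2) by case: c => _; apply; nat_lia.
have t1 : turn e (p i.+1) (p i.+2) (p i.+3) by case: c => _; apply; nat_lia.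
have l12 : ltx (p i.+1) (p i.+2) by apply: lt; nat_lia.
have H q : q \in p i.+1 :: Q i -> [/\ (p i.+1).1 <= q.1, q.1 < (p i.+2).1,
    turn e q (p i.+2) (p i.+3), 0 <= e * det (p i.+1) q (p i.+2) &
    0 <= e * det (p i) (p i.+1) q].
  rewrite inE => /orP[/eqP->|qQ].
    by split; rewrite ?det_aab ?det_abb ?mulr0 // lexx.
  have /and5P[h1 h2 h3 h4 h5] := allP (Qr ir) q qQ.
  by split; rewrite // ltW.
have [a2 a3 a4 a5 a6] := H _ a1.
have [b2 b4 b5 b6] : [/\ ab.2.1 <= (p i.+2).1,
    0 <= e * det ab.2 (p i.+2) (p i.+3), 0 <= e * det (p i.+1) ab.2 (p i.+2) &
    0 <= e * det (p i) (p i.+1) ab.2].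
  move: b1; rewrite mem_rcons inE => /orP[/eqP->|qQ].
    split; rewrite ?lexx // ?det_aab ?det_abb ?mulr0 //; exact: ltW.
  have [|h1 h2 h3 h4 h5] := H ab.2; first by rewrite inE qQ orbT.
  by split; [apply: ltW | apply: ltW | exact: h4 | exact: h5].
case: (su) => /andP[u1 u2] _; split.
- by rewrite (le_trans a2 u1) (lt_le_trans u2 b2).
- by move=> _; rewrite /turn -det_rot; apply: (segment_gt0 su); rewrite det_rot.
- rewrite det_swap mulrN -mulNr; apply: (segment_ge0 su).
    by rewrite mulNr -mulrN -det_swap.
  by rewrite mulNr -mulrN -det_swap.
- by move=> _; apply: (segment_ge0 su).
Qed.

Variable l : set (R * R).
Hypothesis lP : forall u v w, l u -> l v -> l w -> det u v w = 0.

(** Two edges of the cap or cup [Q i], and the two edges that join it to [p i.+1] and [p i.+2]. *)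
Lemma block_hits i : (i < r)%N -> (count (hit l) (edges (block i)) <= 4)%N.
Proof.
move=> ir; have [e' te'] := Qt ir.
apply: leq_trans (count_edges_cons _ _ _) _; rewrite ltnS.
apply: leq_trans (count_edges_rcons _ _ _) _; rewrite ltnS.
exact: chain_hits lP _ _ (Qs ir) te'.
Qed.

(** At most two blocks are hit, each in at most four edges. *)
Lemma path_hits : (count (hit l) (edges (path_from 0 r)) <= 8)%N.
Proof.
pose hb i := has (hit l) (edges (block i)).
have H n i : (i + n <= r)%N ->
    (count (hit l) (edges (path_from i n)) <= 4 * count hb (iota i n))%N.
  elim: n i => [|n IH] i inr //.
  rewrite edges_path_from count_cat [iota _ _]/= [count hb _]/= mulnDr leq_add //.
    rewrite /hb has_count; have := @block_hits i.
    case: (count _ _) => // n' h; rewrite muln1; apply: h; nat_lia.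
  by apply: IH; nat_lia.
apply: leq_trans (H r 0%N _) _ => //.
rewrite -[8%N]/(4 * 2)%N leq_mul2l; apply: count_le2 => i j k ijk kr.
case/hasP=> a ia /asboolP[u [su lu]] /hasP[b ib /asboolP[v [sv lv]]].
case/hasP=> d id /asboolP[w [sw lw]].
have := no_line_hits_three_blocks c (i := i.+1) (j := j.+1) (k := k.+1) _ _
  (block_in_block _ ia su) (block_in_block _ ib sv) (block_in_block _ id sw).
by rewrite (lP lu lv lw) eqxx => h; suff: false by []; apply: h; nat_lia.
Qed.

End Path.

(** * Stabbing numbers and Jordan curves *)

Section Stabbing.
Variable R : realType.
Implicit Types (u v w : R * R) (l J E : set (R * R)).

Lemma line_det0 l u v w : is_line l -> l u -> l v -> l w -> det u v w = 0.
Proof.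
case=> a [b [c [ab ->]]] /= hu hv hw; rewrite /det.
have e1 : a * (v.1 - u.1) = - (b * (v.2 - u.2)) by lra.
have e2 : a * (w.1 - u.1) = - (b * (w.2 - u.2)) by lra.
have [a0|a0] := eqVneq a 0; last first.
  apply: (mulfI a0); rewrite mulr0 mulrBr mulrA e1 (mulrCA a) e2; ring.
have [b0|b0] := eqVneq b 0; first by case: ab; rewrite a0 b0.
move: e1 e2; rewrite a0 !mul0r => /esym/eqP + /esym/eqP.
rewrite !oppr_eq0 !mulf_eq0 (negbTE b0) /= => /eqP-> /eqP->; ring.
Qed.

Definition convex_comb (u v : R * R) (t : R) : R * R :=
  (u.1 + t * (v.1 - u.1), u.2 + t * (v.2 - u.2)).

Lemma line_convex l u v t : is_line l -> l u -> l v -> l (convex_comb u v t).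
Proof.
case=> a [b [c [ab ->]]] /= hu hv.
rewrite (_ : _ + _ = (a * u.1 + b * u.2) + t * ((a * v.1 + b * v.2) -
  (a * u.1 + b * u.2))); last by ring.
by rewrite hu hv subrr mulr0 addr0.
Qed.

Lemma itv_uncountable : ~ countable (`[0, 1]%classic : set R).
Proof.
move/countable_lebesgue_measure0; rewrite lebesgue_measure_itv /= lte_fin ltr01.
by rewrite sube0 => /eqP; rewrite eqe oner_eq0.
Qed.

Lemma segment_uncountable (A : set (R * R)) u v : u <> v ->
  (forall t, 0 <= t <= 1 -> A (convex_comb u v t)) -> ~ countable A.
Proof.
move=> uv hA cA; apply: itv_uncountable.
have inj : {in `[0, 1]%classic &, injective (convex_comb u v)}.
  move=> s t _ _ [/addrI h1 /addrI h2].
  have [d1|d1] := eqVneq (v.1 - u.1) 0; last exact: (mulIf d1).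
  have [d2|d2] := eqVneq (v.2 - u.2) 0; last exact: (mulIf d2).
  case: uv; case: u v d1 d2 {hA h1 h2} => [u1 u2] [v1 v2] /=.
  by move=> /subr0_eq-> /subr0_eq->.
have := inj_card_eq inj; rewrite card_eq_sym => /eq_countable ->.
apply: sub_countable cA; apply: subset_card_le => _ [t /= t01 <-].
by apply: hA; rewrite in_itv /= in t01.
Qed.

Lemma counting_le (A : set (R * R)) (s : seq (R * R)) :
  A `<=` [set` s] -> (counting A <= (size s)%:R%:E :> \bar R)%E.
Proof.
move=> As.
have An : (A #<= `I_(size s))%card.
  apply: (@card_le_trans _ _ _ (nth 0 s @` `I_(size s))); last exact: card_image_le.
  by apply: subset_card_le => x /As /(nthP 0)[i is_ <-]; exists i.
rewrite /counting asboolT; last by apply/finite_set_leP; exists (size s).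
by rewrite lee_fin ler_nat; apply: geq_card_fset_set.
Qed.

(** If a line meets a piece in two distinct points, the segment between them lies in the line and in
    [J], so the intersection is uncountable and the line does not count. Any other line meets each
    piece at most once. *)
Lemma stab_le J (Es : seq (set (R * R))) (d : nat) :
  (forall u, J u -> exists2 i, (i < size Es)%N & nth set0 Es i u) ->
  (forall i u v t, (i < size Es)%N -> nth set0 Es i u -> nth set0 Es i v ->
     0 <= t <= 1 -> J (convex_comb u v t)) ->
  (forall l, is_line l ->
     (count (fun E => `[< exists u, E u /\ l u >]) Es <= d)%N) ->
  (stab J <= d%:R%:E)%E.
Proof.
move=> cov conv cnt; apply: ge_ereal_sup => _ [l [ll cl] <-].
pose hits E := `[< exists u, E u /\ l u >].
pose pick E := xget (0 : R * R) (E `&` l).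
apply: (@le_trans _ _ (size [seq pick E | E <- seq.filter hits Es])%:R%:E).
  apply: counting_le => u [lu Ju] /=.
  have [i iE Eu] := cov u Ju; set E := nth set0 Es i in Eu.
  have hE : hits E by apply/asboolP; exists u.
  have [Ep lp] : (E `&` l) (pick E).
    by apply: (xgetPex 0); exists u.
  suff -> : u = pick E.
    by apply: map_f; rewrite mem_filter hE mem_nth.
  apply: contrapT => up; apply: (segment_uncountable up) cl => t t01.
  by split; [apply: line_convex | apply: (conv i)].
by rewrite lee_fin ler_nat size_map size_filter; apply: cnt.
Qed.

End Stabbing.

(** * Jordan curves made of two graphs *)

Section JordanGraphs.
Variable R : realType.
Variables (f g : R -> R) (a z : R).
Hypothesis az : a < z.
Hypothesis fc : continuous f.
Hypothesis gc : continuous g.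
Hypothesis fga : f a = g a.
Hypothesis fgz : f z = g z.
Hypothesis gf : forall x, a < x < z -> g x < f x.

Definition two_graphs : set (R * R) :=
  [set u | a <= u.1 <= z /\ (u.2 = f u.1 \/ u.2 = g u.1)].

Let X1 (t : R) : R := a + (z - a) * Num.min (2 * t) 1.
Let X2 (t : R) : R := a + (z - a) * Num.min 1 (2 - 2 * t).

(* Runs along [f] for [t <= 1/2] and back along [g] for [1/2 <= t]; the idle
   one of [X1], [X2] is constantly [z]. *)
Let loop (t : R) : R * R := (X1 t + X2 t - z, f (X1 t) + g (X2 t) - f z).

Let loop1 t : t <= 1/2 -> loop t = (a + (z - a) * (2 * t), f (a + (z - a) * (2 * t))).
Proof.
move=> t2; rewrite /loop /X1 /X2 min_l; last by lra.
rewrite min_l; last by lra.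
rewrite mulr1 (_ : a + (z - a) = z); last by ring.
by rewrite -fgz; congr pair; ring.
Qed.

Let loop2 t : 1/2 <= t ->
  loop t = (a + (z - a) * (2 - 2 * t), g (a + (z - a) * (2 - 2 * t))).
Proof.
move=> t2; rewrite /loop /X1 /X2 min_r; last by lra.
rewrite min_r; last by lra.
rewrite mulr1 (_ : a + (z - a) = z); last by ring.
by congr pair; ring.
Qed.

Let loop_continuous : continuous loop.
Proof.
have aff (k m : R) (h : R -> R) : continuous h -> continuous (fun t => k + m * h t).
  move=> hc t; apply: (@cvgD _ _ _ (nbhs t) _ (fun=> k) (fun t => m * h t)).
    exact: (@cvg_cst R).
  by apply: (@cvgM _ _ (nbhs t) _ (fun=> m) h); [exact: (@cvg_cst R)|exact: hc].
have cst (k : R) : continuous (fun _ : R => k) by move=> t; exact: (@cvg_cst R).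
have sub (h k : R -> R) : continuous h -> continuous k ->
    continuous (fun t => h t - k t).
  by move=> ch ck t; apply: (@cvgB _ _ _ (nbhs t) _ h k); [exact: ch|exact: ck].
have add (h k : R -> R) : continuous h -> continuous k ->
    continuous (fun t => h t + k t).
  by move=> ch ck t; apply: (@cvgD _ _ _ (nbhs t) _ h k); [exact: ch|exact: ck].
have c2 : continuous (fun t : R => 2 * t) by exact: mulrl_continuous.
have cX1 : continuous X1.
  apply: aff => t.
  exact: (@continuous_min R R (fun t => 2 * t) (fun _ => 1) t (c2 t) (cst 1 t)).
have cX2 : continuous X2.
  apply: aff => t.
  apply: (@continuous_min R R (fun _ => 1) (fun t => 2 - 2 * t) t (cst 1 t)).
  exact: (sub _ _ (cst 2) c2).
have cf : continuous (f \o X1).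
  by move=> t; apply: continuous_comp; [apply: cX1 | apply: fc].
have cg : continuous (g \o X2).
  by move=> t; apply: continuous_comp; [apply: cX2 | apply: gc].
have c3 := sub _ _ (add _ _ cX1 cX2) (cst z).
have c4 := sub _ _ (add _ _ cf cg) (cst (f z)).
by move=> t; exact: (@cvg_pair R R R (nbhs t) _ _ _ _ _ _ _ (c3 t) (c4 t)).
Qed.

Lemma jordan_two_graphs : jordan_curve two_graphs.
Proof.
have za : 0 < z - a by rewrite subr_gt0.
have za0 : z - a != 0 by rewrite gt_eqF.
exists loop; split.
- exact: continuous_subspaceT.
- have h0 : 0 <= 1/2 :> R by lra.
  have h1 : 1/2 <= 1 :> R by lra.
  by rewrite (loop1 h0) (loop2 h1) mulr1 subrr !mulr0 !addr0 fga.
(* A parameter strictly inside the second half has its abscissa strictly between [a] and [z], where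
   the two graphs are disjoint. *)
- have key s t : s <= 1/2 -> 1/2 < t -> 0 <= s -> t < 1 -> loop s = loop t -> False.
    move=> s2 t2 s0 t1; rewrite loop1 // loop2 ?ltW // => -[/addrI/(mulfI za0) -> E].
    have := gf (x := a + (z - a) * (2 - 2 * t)); rewrite E ltxx => h.
    suff : false by []. apply: h; apply/andP; split; nra.
  move=> s t /[!inE] /= /[!in_itv] /= /andP[s0 s1] /andP[t0 t1] E.
  have [s2|s2] := leP s (1/2); have [t2|t2] := leP t (1/2).
  + by move: E; rewrite !loop1 // => -[/addrI/(mulfI za0) h _]; lra.
  + by case: (key s t).
  + by case: (key t s).
  + by move: E; rewrite !loop2 ?ltW // => -[/addrI/(mulfI za0) h _]; lra.
- apply/seteqP; split=> [[x y] [/= /andP[x0 x1] [->|->]]|_ [t /= + <-]].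
  + exists ((x - a) / (z - a) / 2).
      rewrite /= in_itv /=; apply/andP; split.
        by apply: divr_ge0 => //; apply: divr_ge0; lra.
      by rewrite -mulrA -invfM ler_pdivrMr; lra.
    rewrite loop1; last first.
      by rewrite -mulrA -invfM ler_pdivrMr; lra.
    have -> : a + (z - a) * (2 * ((x - a) / (z - a) / 2)) = x by field.
    by [].
  + exists (1 - (x - a) / (z - a) / 2).
      rewrite /= in_itv /=; apply/andP; split; last first.
        by rewrite gerBl; apply: divr_ge0 => //; apply: divr_ge0; lra.
      by rewrite subr_ge0 -mulrA -invfM ler_pdivrMr; lra.
    rewrite loop2; last first.
      by rewrite lerBrDr -lerBrDl -mulrA -invfM ler_pdivrMr; lra.
    have -> : a + (z - a) * (2 - 2 * (1 - (x - a) / (z - a) / 2)) = x by field.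
    by [].
  + rewrite in_itv /= => /andP[t0 t1].
    have [t2|/ltW t2] := leP t (1/2).
      by rewrite loop1 //; split; [rewrite /=; nra | left].
    by rewrite loop2 //; split; [rewrite /=; nra | right].
Qed.

End JordanGraphs.

(** * Closing up a path *)

Section Interpolation.
Variable R : realType.
Implicit Types (a b : R * R) (s : seq (R * R)) (x y : R).

Definition clamp (lo hi x : R) : R := Num.min hi (Num.max lo x).

Definition slope a b : R := (b.2 - a.2) / (b.1 - a.1).

(* The piecewise linear interpolation of [s], extended by constants. *)
Fixpoint pl s x : R :=
  match s with
  | [::] => 0
  | a :: s' => match s' with
    | [::] => a.2
    | b :: _ => pl s' x + slope a b * (clamp a.1 b.1 x - b.1)
    end
  end.

Lemma pl_cons2 a b s x :
  pl (a :: b :: s) x = pl (b :: s) x + slope a b * (clamp a.1 b.1 x - b.1).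
Proof. by []. Qed.

Lemma clamp_left lo hi x : lo <= hi -> x <= lo -> clamp lo hi x = lo.
Proof. by move=> h1 h2; rewrite /clamp max_l // min_r. Qed.

Lemma clamp_right lo hi x : hi <= x -> clamp lo hi x = hi.
Proof. by move=> h1; rewrite /clamp min_l // le_max h1 orbT. Qed.

Lemma clamp_mid lo hi x : lo <= x <= hi -> clamp lo hi x = x.
Proof. by case/andP=> h1 h2; rewrite /clamp max_r // min_r. Qed.

Lemma clamp_lip lo hi x y : x <= y -> 0 <= clamp lo hi y - clamp lo hi x <= y - x.
Proof.
move=> xy; rewrite /clamp.
have key u : Num.min hi u = if hi <= u then hi else u by rewrite minEle.
case: (leP lo x) => h1; case: (leP lo y) => h2; rewrite !key; apply/andP; split;
  do ?[case: ifPn; rewrite -?ltNge => ?]; lra.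
Qed.

Lemma pl_continuous s : continuous (pl s : R -> R).
Proof.
elim: s => [|a [|b s] IH]; try by move=> t; exact: (@cvg_cst R).
move=> t; set k := slope a b.
have cst (m : R) : continuous (fun _ : R => m) by move=> u; exact: (@cvg_cst R).
have cid : continuous (fun u : R => u) by move=> u; exact: cvg_id.
have c1 : continuous (fun u : R => Num.max a.1 u).
  by move=> u; exact: (@continuous_max R R (fun=> a.1) id u (cst _ u) (cid u)).
have c2 : continuous (clamp a.1 b.1).
  by move=> u; exact: (@continuous_min R R (fun=> b.1) _ u (cst _ u) (c1 u)).
apply: (@cvgD _ _ _ (nbhs t) _ (pl (b :: s))
  (fun u => k * (clamp a.1 b.1 u - b.1))); first exact: IH.
apply: (@cvgM _ _ (nbhs t) _ (fun=> k)); first exact: (@cvg_cst R).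
apply: (@cvgB _ _ _ (nbhs t) _ (clamp a.1 b.1) (fun=> b.1)); first exact: c2.
exact: (@cvg_cst R).
Qed.

(** Each edge contributes its slope times a 1-Lipschitz clamp, so the absolute slopes add up to [L].
    The constant tells how steep the closing lines must be. *)
Lemma pl_lip s : exists2 L, 0 <= L &
  forall x y, x <= y -> `|pl s y - pl s x| <= L * (y - x).
Proof.
elim: s => [|a [|b s] [L L0 IH]].
- by exists 0 => // x y _; rewrite subrr normr0 mul0r.
- by exists 0 => // x y _; rewrite subrr normr0 mul0r.
exists (L + `|slope a b|) => [|x y xy]; first by rewrite addr_ge0.
rewrite !pl_cons2 mulrDl.
rewrite (_ : _ - _ = (pl (b :: s) y - pl (b :: s) x) +
  slope a b * (clamp a.1 b.1 y - clamp a.1 b.1 x)); last by ring.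
apply: le_trans (ler_normD _ _) _; apply: lerD; first exact: IH.
have /andP[h1 h2] := clamp_lip a.1 b.1 xy.
by rewrite normrM ler_wpM2l // ger0_norm.
Qed.

Lemma pl_left a s x : sorted (@ltx R) (a :: s) -> x <= a.1 -> pl (a :: s) x = a.2.
Proof.
elim: s a => [|b s IH] a //= /andP[ab sb] xa.
have := IH b sb (le_trans xa (ltW ab)); rewrite /= => ->.
rewrite clamp_left ?(ltW ab) // /slope; field.
by rewrite subr_eq0 gt_eqF.
Qed.

Lemma pl_vertex s a : sorted (@ltx R) s -> a \in s -> pl s a.1 = a.2.
Proof.
elim: s => [|b s IH] // ss; rewrite inE => /orP[/eqP->|as_].
  by rewrite pl_left.
case: s IH ss as_ => // c s IH ss as_.
rewrite pl_cons2 clamp_right ?subrr ?mulr0 ?addr0.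
  by apply: IH => //; move: ss => /= /andP[].
move: ss => /= /andP[_]; rewrite path_sortedE; last exact: ltx_trans.
case/andP=> /allP H _; move: as_; rewrite inE => /orP[/eqP->//|].
by move=> /H/ltW.
Qed.

Lemma sorted_head_le a b s : sorted (@ltx R) (a :: s) -> b \in a :: s -> a.1 <= b.1.
Proof.
rewrite /= path_sortedE; last exact: ltx_trans.
by case/andP=> /allP H _; rewrite inE => /orP[/eqP->//|/H/ltW].
Qed.

Lemma sorted_last_ge a b s : sorted (@ltx R) (a :: s) -> b \in a :: s ->
  b.1 <= (last a s).1.
Proof.
elim: s a b => [|c s IH] a b; first by move=> _; rewrite inE => /eqP->.
move=> /= /andP[ac sc]; rewrite inE => /orP[/eqP->|bs]; last exact: IH sc bs.
by apply: le_trans (ltW ac) _; apply: IH => //; rewrite mem_head.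
Qed.

Lemma segment_pl e s u : sorted (@ltx R) s -> e \in edges s -> segment e u ->
  u.2 = pl s u.1.
Proof.
elim: s => [|a [|b s] IH] // ss; rewrite edges_cons2 inE.
have /andP[ab sb] := ss.
have ba : b.1 - a.1 != 0 by rewrite subr_eq0 gt_eqF.
case/orP=> [/eqP->|es] su.
  case: su => /andP[u1 u2] du.
  rewrite /= in u1 u2 du.
  rewrite pl_cons2 pl_left ?(ltW u2) // clamp_mid ?u1 ?(ltW u2) //.
  apply: (mulfI ba); rewrite /slope mulrDr mulrA (mulrCA (b.1 - a.1)).
  rewrite divff // mulr1; move: du; rewrite /det => du; lra.
have [e1 _ _] := edgesP sb es.
rewrite pl_cons2 clamp_right ?subrr ?mulr0 ?addr0; first exact: IH.
case: su => /andP[u1 _] _; apply: le_trans u1.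
by apply: sorted_head_le sb _; apply: mem_belast.
Qed.

Lemma pl_segment a s x : sorted (@ltx R) (a :: s) -> a.1 <= x < (last a s).1 ->
  exists2 e, e \in edges (a :: s) & segment e (x, pl (a :: s) x).
Proof.
elim: s a => [|b s IH] a ss /andP[ax xl]; first by move: (le_lt_trans ax xl); rewrite ltxx.
have /andP[ab sb] := ss.
have ba : b.1 - a.1 != 0 by rewrite subr_eq0 gt_eqF.
have [xb|bx] := ltP x b.1.
  exists (a, b); first by rewrite edges_cons2 mem_head.
  split; first by rewrite /= ax.
  rewrite pl_cons2 pl_left ?ltW // clamp_mid ?ax ?ltW // /slope /det /=.
  by field.
have [|e es se] := IH b sb; first by rewrite bx.
exists e; first by rewrite edges_cons2 inE es orbT.
by rewrite pl_cons2 clamp_right // subrr mulr0 addr0.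
Qed.

End Interpolation.

Section Curve.
Variable R : realType.
Implicit Types (s : seq (R * R)) (u v : R * R).

Lemma convex_comb_le (m n x y t : R) : m <= x <= n -> m <= y <= n -> 0 <= t <= 1 ->
  m <= x + t * (y - x) <= n.
Proof.
move=> /andP[h1 h2] /andP[h3 h4] /andP[t0 t1].
by apply/andP; split; nra.
Qed.

Lemma segment_convex (e : (R * R) * (R * R)) u v t : segment e u -> segment e v ->
  0 <= t <= 1 -> segment e (convex_comb u v t).
Proof.
case=> /andP[u1 u2] du [/andP[v1 v2] dv] /andP[t0 t1]; split.
  apply/andP; split => /=; first nra.
  rewrite -subr_gt0 (_ : _ - _ = (1 - t) * (e.2.1 - u.1) + t * (e.2.1 - v.1));
    last by ring.
  move: t0; rewrite le_eqVlt => /orP[/eqP<-|t0].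
    by rewrite mul0r addr0 subr0 mul1r subr_gt0.
  apply: ltr_wpDl; first by apply: mulr_ge0; rewrite subr_ge0 // ltW.
  by apply: mulr_gt0; rewrite // subr_gt0.
have -> : det e.1 e.2 (convex_comb u v t) =
  det e.1 e.2 u + t * (det e.1 e.2 v - det e.1 e.2 u) by rewrite /det /=; ring.
by rewrite du dv subrr mulr0 addr0.
Qed.

Lemma count_cons2 (T : Type) (P : pred T) (x y : T) (t : seq T) :
  (count P [:: x, y & t] <= (count P t).+2)%N.
Proof. by rewrite /=; case: (P x); case: (P y) => /=; lia. Qed.

(* The interpolation of [s] is closed up from below by two steep lines. *)
Lemma d_curve_through a b s (d : nat) : sorted (@ltx R) [:: a, b & s] ->
  (forall l, is_line l -> (count (hit l) (edges [:: a, b & s]) <= d)%N) ->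
  exists J, d_curve d.+2 J /\ [set` [:: a, b & s]] `<=` J.
Proof.
set V := [:: a, b & s] => sV hV.
have [L L0 HL] := pl_lip V; set f := pl V in HL.
set z := last b s.
have Vz : z \in V by rewrite inE mem_last orbT.
have az : a.1 < z.1.
  case/andP: (sV) => ab sb; apply: lt_le_trans ab _.
  by apply: (sorted_last_ge (a := b) (b := b) (s := s)); rewrite ?mem_head.
(* The lines fall from the two end points with slope [L + 1], steeper than [f] can be, so their
   maximum [g] stays strictly below [f] between the ends. *)
pose g1 x := f a.1 - (L + 1) * (x - a.1).
pose g2 x := f z.1 - (L + 1) * (z.1 - x).
pose g x := Num.max (g1 x) (g2 x).
have lin (k m c : R) : continuous (fun x : R => k + m * (x - c)).
  move=> x; apply: (@cvgD _ _ _ (nbhs x) _ (fun=> k) (fun x => m * (x - c))).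
    exact: (@cvg_cst R).
  apply: (@cvgM _ _ (nbhs x) _ (fun=> m)); first exact: (@cvg_cst R).
  by apply: (@cvgB _ _ _ (nbhs x) _ id (fun=> c)); [exact: cvg_id|exact: (@cvg_cst R)].
have g1c : continuous g1.
  have -> : g1 = fun x => f a.1 + - (L + 1) * (x - a.1) by apply/funext => x; rewrite mulNr.
  exact: lin.
have g2c : continuous g2.
  have -> : g2 = fun x => f z.1 + (L + 1) * (x - z.1).
    by apply/funext => x; rewrite /g2; ring.
  exact: lin.
have gc : continuous g by move=> x; exact: (@continuous_max R R g1 g2 x (g1c x) (g2c x)).
have K0 : 0 < L + 1 by lra.
have Kf x y : x <= y -> f y - L * (y - x) <= f x <= f y + L * (y - x).
  by move=> /HL; rewrite ler_norml => /andP[h1 h2]; apply/andP; split; lra.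
have fa : f a.1 = g a.1.
  rewrite /g max_l; first by rewrite /g1 subrr mulr0 subr0.
  have /andP[h1 h2] := Kf _ _ (ltW az).
  by rewrite /g1 /g2; nra.
have fz : f z.1 = g z.1.
  rewrite /g max_r; first by rewrite /g2 subrr mulr0 subr0.
  have /andP[h1 h2] := Kf _ _ (ltW az).
  by rewrite /g1 /g2; nra.
have gf x : a.1 < x < z.1 -> g x < f x.
  move=> /andP[ax xz]; rewrite gt_max /g1 /g2.
  have /andP[h1 h2] := Kf _ _ (ltW ax); have /andP[h3 h4] := Kf _ _ (ltW xz).
  by apply/andP; split; nra.
pose J := two_graphs f g a.1 z.1.
pose G1 : set (R * R) := [set u | [/\ a.1 <= u.1 <= z.1, u.2 = g1 u.1 & g2 u.1 <= g1 u.1]].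
pose G2 : set (R * R) := [set u | [/\ a.1 <= u.1 <= z.1, u.2 = g2 u.1 & g1 u.1 <= g2 u.1]].
(* Two pieces for the lower boundary, which turn [d] into [d.+2], and one for each edge of the
   path. *)
pose Es := G1 :: G2 :: [seq segment e | e <- edges V].
have szE : size Es = (size (edges V)).+2 by rewrite -(size_map (@segment R)).
have nthE i : (i < size (edges V))%N ->
    nth set0 Es i.+2 = segment (nth (a, a) (edges V) i).
  exact: nth_map.
exists J; split; last first.
  move=> u uV; split; last by left; rewrite /f pl_vertex.
  by rewrite (sorted_head_le sV uV) (sorted_last_ge sV uV).
split; first by apply: jordan_two_graphs => //; apply: pl_continuous.
have g_cov u : a.1 <= u.1 <= z.1 -> u.2 = g u.1 -> G1 u \/ G2 u.
  move=> au; rewrite /g; case: leP => h hu; first by right.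
  by left; split => //; apply: ltW.
apply: (stab_le (Es := Es)).
- move=> u [au uJ].
  (* The right end point lies on no half-open segment; it is assigned to [g], which agrees with [f]
     there. *)
  have {uJ}[[ul uf]|ug] : (u.1 < z.1 /\ u.2 = f u.1) \/ u.2 = g u.1.
    case: uJ => [uf|]; last by right.
    case/andP: (au) => _; rewrite le_eqVlt => /orP[/eqP uz|]; last by left.
    by right; rewrite uf uz.
  + case/andP: au => au _.
    have [|e es se] := pl_segment sV (x := u.1); first by rewrite au.
    have Eu : u = (u.1, pl V u.1) by rewrite [LHS]surjective_pairing uf.
    have ie : (index e (edges V) < size (edges V))%N by rewrite index_mem.
    exists (index e (edges V)).+2; first by rewrite szE.
    by rewrite (nthE _ ie) nth_index // Eu.
  + by have [h|h] := g_cov _ au ug; [exists 0%N|exists 1%N].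
- move=> [|[|i]] u v t; rewrite szE => iE.
  + case=> u1 u2 u3 [v1 v2 v3] t01; have cc := convex_comb_le u1 v1 t01.
    split => //; right => /=; rewrite /g max_l.
      by rewrite u2 v2 /g1; ring.
    by move: t01 => /andP[t0 t1]; rewrite /g1 /g2 in u3 v3 *; nra.
  + case=> u1 u2 u3 [v1 v2 v3] t01; have cc := convex_comb_le u1 v1 t01.
    split => //; right => /=; rewrite /g max_r.
      by rewrite u2 v2 /g2; ring.
    by move: t01 => /andP[t0 t1]; rewrite /g1 /g2 in u3 v3 *; nra.
  + rewrite (nthE _ iE); set e := nth _ _ _ => su sv t01.
    have es : e \in edges V by apply: mem_nth.
    have sw := segment_convex su sv t01.
    split; last by left; apply: segment_pl sw.
    have [e1 e2 _] := edgesP sV es.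
    case: sw => /andP[w1 w2] _.
    rewrite (le_trans _ w1) ?(le_trans (ltW w2)) //.
      by apply: (sorted_last_ge sV); rewrite inE e2 orbT.
    by apply: (sorted_head_le sV); apply: mem_belast.
- move=> l ll; apply: leq_trans (count_cons2 _ _ _ _) _.
  by rewrite !ltnS count_map; apply: hV.
Qed.

End Curve.

(** * The upper bound *)

Section UpperBound.
Variable R : realType.
Implicit Types (P : set (R * R)) (s t : seq (R * R)).

Lemma collinear_line (p q z : R * R) : p <> q -> det p q z = 0 ->
  exists l, [/\ is_line l, l p, l q & l z].
Proof.
move=> pq pqz; pose a := - (q.2 - p.2); pose b := q.1 - p.1.
exists [set u | a * u.1 + b * u.2 = a * p.1 + b * p.2]; split => //=.
- exists a, b, (a * p.1 + b * p.2); split => // -[/eqP].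
  rewrite oppr_eq0 subr_eq0 => /eqP h2 /eqP; rewrite subr_eq0 => /eqP h1.
  by apply: pq; case: p q h1 h2 {pqz a b} => [? ?] [? ?] /= -> ->.
- by rewrite /a /b; ring.
- by move: pqz; rewrite /det /a /b => h; lra.
Qed.

Lemma general_position_generic P s : general_position P -> (forall p, p \in s -> P p) ->
  generic s.
Proof.
move=> gP sP p q z ps qs zs pq qz; apply/eqP => pqz.
have ne (u v : R * R) : ltx u v -> u <> v by move=> + E; rewrite E /ltx ltxx.
have pz := ltx_trans pq qz.
case: (gP p q z (sP _ ps) (sP _ qs) (sP _ zs) (ne _ _ pq) (ne _ _ qz) (ne _ _ pz)).
by apply: collinear_line pqz; apply: ne.
Qed.

Lemma vertical_collinear (p q z : R * R) : p.1 = q.1 -> p.1 = z.1 -> det p q z = 0.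
Proof. by rewrite /det => -> ->; rewrite subrr mul0r mulr0 subrr. Qed.

(** A vertical line contains at most two of the points, so keeping one point per abscissa loses at
    most half of them. *)
Lemma distinct_abscissae P s : general_position P -> uniq s ->
  (forall p, p \in s -> P p) ->
  exists t, [/\ {subset t <= s}, uniq (map fst t) & (size s <= (size t).*2)%N].
Proof.
move=> gP; have [n] := ubnP (size s).
elim: n s => // n IH [|p s] sn us sP; first by exists [::].
pose same (q : R * R) := q.1 == p.1.
have st (Q : pred (R * R)) : {subset seq.filter Q s <= s}.
  by move=> q; rewrite mem_filter => /andP[].
have [|||t [ts ut tn]] := IH (seq.filter (predC same) s).
- by apply: leq_trans (_ : (size s).+1 <= _)%N; rewrite ?ltnS ?size_filter ?count_size //.
- by rewrite filter_uniq //; case/andP: us.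
- by move=> q /st qs; apply: sP; rewrite inE qs orbT.
have few : (count same s <= 1)%N.
  rewrite -size_filter leqNgt; apply/negP.
  have : uniq (seq.filter same s) by rewrite filter_uniq //; case/andP: us.
  have : forall q, q \in seq.filter same s -> [/\ q.1 = p.1, q != p & P q].
    move=> q; rewrite mem_filter => /andP[/eqP qp qs]; split => //.
      by apply: contraTneq us => <- /=; rewrite qs.
    by apply: sP; rewrite inE qs orbT.
  case: (seq.filter _ _) => [|q [|z l]] //= H /andP[]; rewrite inE negb_or.
  case/andP=> qz _ _ _.
  have [q1 q2 q3] := H q (mem_head _ _).
  have [|z1 z2 z3] := H z; first by rewrite !inE eqxx orbT.
  have pq : p <> q by apply/eqP; rewrite eq_sym.
  have pz : p <> z by apply/eqP; rewrite eq_sym.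
  case: (gP p q z (sP _ (mem_head _ _)) q3 z3 pq (elimN eqP qz) pz).
  by apply: collinear_line pq _; apply: vertical_collinear.
exists (p :: t); split.
- move=> q; rewrite !inE => /orP[->//|/ts/st->]; exact: orbT.
- rewrite /= ut andbT; apply/negP => /mapP[q /ts qt E].
  by move: qt; rewrite mem_filter /= /same E eqxx.
- rewrite size_filter in tn; rewrite /= doubleS ltnS -(count_predC same s).
  by rewrite -add1n leq_add.
Qed.

Lemma sorted_subset P N : general_position P -> (`I_(N.*2) #<= P)%card ->
  exists s, [/\ sorted (@ltx R) s, generic s, (N <= size s)%N & forall p, p \in s -> P p].
Proof.
move=> gP /pcard_leP[f].
pose u := [seq f i | i <- iota 0 N.*2].
have uu : uniq u.
  rewrite map_inj_in_uniq ?iota_uniq // => i j; rewrite !mem_iota => iN jN.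
  by apply: inj; rewrite inE.
have uP p : p \in u -> P p.
  by case/mapP=> i; rewrite mem_iota => iN ->; apply: funS.
have [t [ts ut tn]] := distinct_abscissae gP uu uP.
have lex_tot : total (fun a b : R * R => a.1 <= b.1) by move=> a b; apply: le_total.
exists (sort (fun a b => a.1 <= b.1) t).
have sP p : p \in sort (fun a b : R * R => a.1 <= b.1) t -> P p.
  by rewrite mem_sort => /ts/uP.
split => //; last by rewrite size_sort; move: tn; rewrite size_map size_iota leq_double.
  have := lt_sorted_uniq_le (map fst (sort (fun a b => a.1 <= b.1) t)).
  rewrite (perm_uniq (perm_map _ (permEl (perm_sort _ _)))) ut /=.
  by rewrite !sorted_map (sort_sorted lex_tot).
exact: general_position_generic gP sP.
Qed.

Lemma path_from_mem (p : nat -> R * R) (Q : nat -> seq (R * R)) s i n :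
  (forall j, (j <= i + n)%N -> p j.+1 \in s) ->
  (forall j, (j < i + n)%N -> {subset Q j <= s}) ->
  {subset path_from p Q i n <= s}.
Proof.
elim: n i => [|n IH] i ps Qs x /=; first by rewrite inE => /eqP->; apply: ps; lia.
rewrite inE mem_cat => /or3P[/eqP->|xQ|]; first by apply: ps; lia.
  by apply: Qs xQ; lia.
by apply: IH => j jn; [apply: ps; lia | apply: Qs; lia].
Qed.

Lemma d_curve_mono (d d' : nat) (J : set (R * R)) : (d <= d')%N ->
  d_curve d J -> d_curve d' J.
Proof.
by move=> dd [jJ sJ]; split => //; apply: le_trans sJ _; rewrite lee_fin ler_nat.
Qed.

(** The path is hit at most 8 times and its closure adds 2. The [r] clusters alone supply [k.+1 * r]
    points; doubling [D] pays for repeated abscissae. *)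
Lemma forces_10_curve (r : nat) : (0 < r)%N -> exists D : nat,
  forall k n, (n <= k.+1 * r)%N -> forces_d_curve R n 10 (D * 4 ^ k).
Proof.
move=> r0; have [D D0 HD] := @rich_clusters R r.
exists D.*2 => k n nk P gP; rewrite -doubleMl => /(sorted_subset gP)[s [ss gs sn sP]].
have [e [p [Q [c ps H]]]] := HD k s ss gs sn.
have Qs i : (i < r)%N -> sorted (@ltx R) (Q i) by case/H.
have Qr i : (i < r)%N -> all (region e (p i) (p i.+1) (p i.+2) (p i.+3)) (Q i) by case/H.
have Qt i : (i < r)%N -> exists e', turning e' (Q i) by case/H.
set V := path_from p Q 0 r.
have sV : sorted (@ltx R) V by apply: path_from_sorted c Qs Qr _ _ _.
have V_hits l : is_line l -> (count (hit l) (edges V) <= 8)%N.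
  move=> ll; apply: path_hits c Qs Qr Qt _ _ => u v w lu lv lw.
  exact: line_det0 ll lu lv lw.
have Vn : (n <= size V)%N.
  by apply: leq_trans nk _; apply: (@size_path_from _ p Q r) => // j jr; case: (H j jr).
have Vs : {subset V <= s}.
  apply: path_from_mem => j jr; first by apply: ps; lia.
  by case: (H j) => //.
(* As [r] is positive, the path contains both [p 1] and [p 2]. *)
have V2 : (1 < size V)%N.
  by rewrite /V -(prednK r0) /= size_cat path_fromE /=; lia.
have [J [dJ VJ]] : exists J, d_curve 10 J /\ [set` V] `<=` J.
  by case: V sV V_hits V2 {Vn Vs} => [|a [|b t]] // sV hV _; apply: d_curve_through.
have un := sorted_ltx_uniq sV.
exists (nth 0 V @` `I_n), J; split => //.
- by move=> _ [i /= ni <-]; apply/sP/Vs; rewrite mem_nth // (leq_trans ni).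
- apply: inj_card_eq => i j; rewrite !inE /= => ni nj /eqP.
  by rewrite nth_uniq ?(leq_trans ni) ?(leq_trans nj) // => /eqP.
- by move=> _ [i /= ni <-]; apply: VJ => /=; rewrite mem_nth // (leq_trans ni).
Qed.

Lemma is_F_exists (n d m : nat) : forces_d_curve R n d m ->
  exists2 F, is_F R n d F & (F <= m)%N.
Proof.
move=> fm; have ex : exists m, `[< forces_d_curve R n d m >] by exists m; apply/asboolP.
case: (ex_minnP ex) => F /asboolP fF minF; exists F; last exact/minF/asboolP.
by split => // m' fm'; apply/minF/asboolP.
Qed.

End UpperBound.

Unset Implicit Arguments.

Theorem theorem5p3 (R : realType) :
  exists (C : R) (d0 : nat), 0 < C /\
    forall d : nat, (d0 <= d)%N ->
    exists eps : nat -> R,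
      ((fun n : nat => eps n / n%:R) @ \oo --> (0 : R)) /\
      \forall n \near \oo, exists F : nat,
        is_F R n d F /\
        F%:R <= 2 `^ ((1 + C / Num.sqrt d%:R) * (n%:R / d%:R) + eps n).
Proof.
(* The threshold 10 is the stabbing number achieved by [forces_10_curve]. *)
exists 1, 10%N; split => // d d10.
have d0 : (0 < d)%N by lia.
(* With [2 d] clusters, [k] is the integer part of [n / (2 d)], and [4 ^ k] is at most 2 to the
   power [n / d]. *)
have [|D HD] := @forces_10_curve R d.*2; first by rewrite double_gt0.
(* A constant error term suffices: the factor [D] is at most [2 ^ D]. *)
exists (fun=> D%:R); split.
  (* After the shift, the quotient is [D] times the harmonic sequence, whose denominators start at
     1. *)
  rewrite -cvg_shiftS.
  have := @cvgM R nat \oo _ (fun=> D%:R) harmonic _ _ (cvg_cst _) cvg_harmonic.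
  by rewrite mulr0 => h; apply: h.
apply: nearW => n; pose k := (n %/ d.*2)%N.
have nk : (n <= k.+1 * d.*2)%N by rewrite ltnW // ltn_ceil // double_gt0.
have [|F isF Fm] := @is_F_exists R n d (D * 4 ^ k).
  move=> P gP Pm; have [S [J [SP Sn dJ SJ]]] := HD k n nk P gP Pm.
  by exists S, J; split => //; apply: d_curve_mono dJ.
exists F; split => //.
have Fle : (F <= 2 ^ (D + k.*2))%N.
  apply: leq_trans Fm _; rewrite expnD leq_mul ?(ltnW (ltn_expl _ _)) //.
  by rewrite -mul2n expnM.
apply: (@le_trans _ _ (2 `^ (D + k.*2)%:R)).
  by rewrite powR_mulrn // -natrX ler_nat.
apply: ler_powR; first by rewrite ler1n.
rewrite natrD addrC lerD2r.
have nd0 : 0 <= n%:R / d%:R :> R by rewrite divr_ge0.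
apply: (@le_trans _ _ (n%:R / d%:R)).
  rewrite ler_pdivlMr ?ltr0n // -natrM ler_nat.
  by have := leq_trunc_div n d.*2; rewrite -/k; lia.
by rewrite ler_peMl // lerDl divr_ge0 // sqrtr_ge0.
Qed.
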